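(* Let $f(t)\in\mathbb{Z}[t]$ be a nonzero polynomial having at least one irreducible factor $h(t)\in\mathbb{Z}[t]$ that is non-constant, is not cyclotomic (up to sign, i.e. $h\neq\pm\Phi_d$ for all $d\geq 1$), and satisfies $h(t)\neq\pm t$. For each positive integer $n$ let $g(t)=t^n-1$, $z(t)=(f(t),g(t))$, $F(t)=f(t)/z(t)$ and $G(t)=g(t)/z(t)$. Then, for any positive integer $k$, there are at most finitely many positive integers $n$ for which $\mathrm{Res}(F,G)\leq k$.
   Context: For polynomials $p,q\in\mathbb{Z}[t]$, $(p(t),q(t))$ denotes their monic greatest common divisor, and $\mathrm{Res}(p,q)$ denotes the absolute value of the resultant of $p$ and $q$. (When $q$ is monic, $\mathrm{Res}(p,q)=\left|\prod_{q(\theta)=0}p(\theta)\right|$, the product being over the roots of $q$ in $\mathbb{C}$ with multiplicity; the empty product is $1$.) $\Phi_d$ denotes the $d$-th cyclotomic polynomial. *)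

(* Defs.v *)
From HB Require Import structures.
From mathcomp Require Import all_boot all_order all_algebra all_field.
From mathcomp Require Import boolp classical_sets functions cardinality.

Set Implicit Arguments.
Unset Strict Implicit.
Unset Printing Implicit Defensive.

Import Order.TTheory GRing.Theory Num.Theory.
Local Open Scope ring_scope.

(* Irreducible elements of a domain.  On {poly int} this is irreducibility in
   Z[t], so it also rules out non-unit contents; [irreducible_poly] would be
   irreducibility over Q. *)
Definition irreducible_elt (R : idomainType) (x : R) : Prop :=
  [/\ x != 0, x \isn't a GRing.unit &
      forall a b : R, x = a * b -> a \is a GRing.unit \/ b \is a GRing.unit].

(* Divisibility in the ring itself; on {poly int} the relation [%|] is
   pseudo-divisibility, i.e., divisibility over Q. *)
Definition ring_dvd (R : idomainType) (d x : R) : Prop := exists c, x = c * d.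

(* [gcdp] over int is only defined up to a nonzero integer factor; when one of
   the arguments is monic, [zprimitive] selects the monic representative, see
   [monic_gcdP] and [monic_gcd_unique]. *)
Definition monic_gcd (p q : {poly int}) : {poly int} := zprimitive (gcdp p q).

Definition Res (p q : {poly int}) : nat := `|resultant p q|%N.

Lemma monic_gcdP (p q : {poly int}) : q \is monic ->
  [/\ monic_gcd p q \is monic,
      ring_dvd (monic_gcd p q) p, ring_dvd (monic_gcd p q) q &
      forall d, ring_dvd d p -> ring_dvd d q -> ring_dvd d (monic_gcd p q)].
Proof.
move=> mq; rewrite /monic_gcd; set z := gcdp p q.
have nz : z != 0 by rewrite gcdp_eq0 (negbTE (monic_neq0 mq)) andbF.
have [a Da] := dvdpP_int (dvdp_gcdl p q).
have [b Db] := dvdpP_int (dvdp_gcdr p q).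
split.
- rewrite monicE; have /eqP := sgz_lead_primitive z; rewrite nz.
  move/monicP: (mq); rewrite Db lead_coefM => /eqP lb.
  have : lead_coef (zprimitive z) \is a GRing.unit.
    by apply/unitrPr; exists (lead_coef b); apply/eqP.
  by rewrite qualifE /= => /orP [] /eqP ->.
- by exists a; rewrite mulrC.
- by exists b; rewrite mulrC.
move=> d [u Du] [v Dv].
have ld : lead_coef d \is a GRing.unit.
  apply/unitrPr; exists (lead_coef v).
  by rewrite mulrC -lead_coefM -Dv; apply/monicP.
have dz : d %| zprimitive z.
  have : d %| z by rewrite dvdp_gcd Du Dv !dvdp_mull.
  by rewrite {1}[z]zpolyEprim dvdpZr // zcontents_eq0.
by exists (zprimitive z %/ d); rewrite Pdiv.IdomainUnit.divpK.
Qed.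

Lemma monic_gcd_unique (p q z : {poly int}) : q \is monic -> z \is monic ->
    ring_dvd z p -> ring_dvd z q ->
    (forall d, ring_dvd d p -> ring_dvd d q -> ring_dvd d z) ->
  z = monic_gcd p q.
Proof.
move=> mq mz zp zq zmax; have [mg gp gq gmax] := monic_gcdP p mq.
have [u Du] := zmax _ gp gq; have [v Dv] := gmax _ zp zq.
apply/eqP; rewrite -eqp_monic //.
by apply/andP; split; [rewrite Dv | rewrite Du]; apply: dvdp_mull.
Qed.

(* Pseudo-division by the monic gcd is exact division in Z[t]. *)
Lemma divp_monic_gcd (p q : {poly int}) : q \is monic ->
  p = p %/ monic_gcd p q * monic_gcd p q /\
  q = q %/ monic_gcd p q * monic_gcd p q.
Proof.
case/(monic_gcdP p) => mg [u Du] [v Dv] _.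
by split; apply/eqP; rewrite -Pdiv.IdomainMonic.dvdp_eq //;
  [rewrite {2}Du | rewrite {2}Dv]; apply: dvdp_mull.
Qed.

(* Main.v *)
Require Import Defs.
From HB Require Import structures.
From mathcomp Require Import all_boot all_order all_fingroup all_algebra all_field.
From mathcomp Require Import ring zify.
From mathcomp Require Import boolp classical_sets functions cardinality.
From mathcomp Require finmap.

(* Since [h] has no root of unity among its roots, [h] divides [F] in Z[t], and
   Res(F, G) >= Res(h, G) = Res(h, t^n - 1) / Res(h, z), where Res(h, z) is bounded
   because the roots of [z] are distinct roots of [f].  So it is enough that
   Res(h, t^n - 1) <= K for finitely many [n] only.  Roots on the unit circle are
   not handled by lower bounds on |z^n - 1|, but as in Hansel's proof of the
   Skolem-Mahler-Lech theorem.  Let [a] be the leading coefficient of [h], z_i its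
   roots, and [C] an integer matrix with eigenvalues a z_i; then det(C^n - a^n) is,
   up to sign and a power of [a], Res(h, t^n - 1).  For a suitable prime [p] and
   some [N], C^N = 1 and a^N = 1 modulo p^2, so on each progression n = r + N m the
   condition Res(h, t^n - 1) <= K reads f(m) = 0, where the [j]-th differences of
   [f] are divisible by p^(2j).  By Newton interpolation, [T] zeros of [f] force p^T
   to divide all its values; hence [f] has finitely many zeros unless it vanishes
   identically.  The latter is excluded by Dirichlet's approximation theorem: for
   suitable large [m], z^(r + N m) is close to z^r for all unimodular roots [z], so
   that Res(h, t^n - 1) is unbounded on each progression. *)

Set Implicit Arguments.
Unset Strict Implicit.
Unset Printing Implicit Defensive.

Import Order.TTheory GRing.Theory Num.Theory.
Local Open Scope classical_set_scope.
Local Open Scope ring_scope.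

Local Notation pZtoC := (map_poly (intr : int -> algC)).

(** * Resultants with a monic polynomial *)

Lemma det_prod (R : comNzRingType) n (I : Type) (s : seq I) (A : I -> 'M[R]_n.+1) :
  \det (\prod_(i <- s) A i) = \prod_(i <- s) \det (A i).
Proof. by elim/big_rec2: _ => [|i x y _ <-]; rewrite ?det1 // -mulmxE det_mulmx. Qed.

Lemma char_poly_horner (R : comNzRingType) n (A : 'M[R]_n) (x : R) :
  (char_poly A).[x] = \det (x%:M - A).
Proof.
rewrite /char_poly -horner_evalE -det_map_mx; congr (\det _).
apply/matrixP => i j; rewrite !mxE /= /horner_eval !hornerE.
by case: (i == j); rewrite ?mulr1n ?mulr0n ?hornerE.
Qed.

Lemma det_horner_mx (F : closedFieldType) n (A : 'M[F]_n.+1) (s : seq F) (p : {poly F}) :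
  char_poly A = \prod_(b <- s) ('X - b%:P) ->
  \det (horner_mx A p) = \prod_(b <- s) p.[b].
Proof.
move=> cA; have sz_s : size s = n.+1.
  by have := size_char_poly A; rewrite cA size_prod_XsubC => -[].
have [r ->] := closed_field_poly_normal p; move: (lead_coef p) => c.
rewrite linearZ /= detZ rmorph_prod /= det_prod.
under [RHS]eq_bigr do rewrite hornerZ horner_prod.
rewrite big_split /= big_const_seq count_predT sz_s iter_mulr_1; congr (_ * _).
rewrite exchange_big /=; apply: eq_bigr => x _.
rewrite rmorphB /= horner_mx_X horner_mx_C -opprB -scaleN1r detZ -char_poly_horner.
rewrite cA horner_prod -sz_s -[(-1) ^+ _]iter_mulr_1 -(count_predT s) -big_const_seq.
by rewrite -big_split /=; apply: eq_bigr => b _; rewrite !hornerE; ring.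
Qed.

Section Resultant.
Variable F : fieldType.

Lemma rVpolyM_companion (q : {poly F}) (v : 'rV[F]_(size q).-1) : q \is monic ->
  rVpoly (v *m companionmx q) = (rVpoly v * 'X) %% q.
Proof.
move=> mq; set d := (size q).-1 in v *.
have szq : size q = d.+1 by rewrite prednK // size_poly_gt0 monic_neq0.
have hD (i : 'I_d) : rVpoly (delta_mx 0 i *m companionmx q) = ('X^i * 'X) %% q.
  rewrite -exprSr; have [id|di] := ltnP i.+1 d.
    by rewrite (mulmx_delta_companion id) rVpoly_delta modp_small // size_polyXn szq.
  have Ei : i.+1 = d by apply/eqP; rewrite eqn_leq ltn_ord di.
  (* For the last basis vector, X^d is [1 * q] plus a remainder, which is the last row of the
     companion matrix. *)
  apply: (@modpP _ _ 1 q); last first.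
    by apply: leq_ltn_trans (size_poly _ _) _; rewrite szq.
  apply/polyP => k; rewrite mul1r coefD coefXn coef_rVpoly.
  case: insubP => [j _ <-|]; last first.
    rewrite -leqNgt addr0 leq_eqVlt Ei eq_sym; case: eqP => /= [->|_ dk].
      by move/monicP: mq; rewrite lead_coefE => ->.
    by rewrite nth_default // szq.
  have jd : (j == i.+1 :> nat) = false by rewrite Ei ltn_eqF.
  have id : (i == d.-1 :> nat) by apply/eqP/succn_inj; rewrite Ei prednK // -Ei.
  by rewrite -rowE !mxE jd id addrN.
rewrite (row_sum_delta v) mulmx_suml !raddf_sum mulr_suml /=.
rewrite (@big_morph _ _ (fun p => p %% q) 0 +%R) ?mod0p //; last by move=> *; rewrite modpD.
apply: eq_bigr => i _.
by rewrite -scalemxAl !linearZ /= hD rVpoly_delta -scalerAl modpZl.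
Qed.

(** Stated for any [C] acting as multiplication by X modulo [q], so that the dimension can have the
    form [n.+1] instead of [(size q).-1]. *)
Lemma row_horner_companion (q p : {poly F}) n (C : 'M[F]_n.+1) :
  size q = n.+2 -> (forall v, rVpoly (v *m C) = (rVpoly v * 'X) %% q) ->
  forall v, rVpoly (v *m horner_mx C p) = (rVpoly v * p) %% q.
Proof.
move=> szq hC; elim/poly_ind: p => [|p c IH] v.
  by rewrite rmorph0 mulmx0 raddf0 mulr0 mod0p.
rewrite rmorphD rmorphM /= horner_mx_X horner_mx_C mulmxDr -mulmxE mulmxA.
rewrite raddfD /= hC IH mul_mx_scalar linearZ /= mulrDr mulrA modpD.
rewrite [rVpoly v * c%:P]mulrC mul_polyC.
congr (_ + _); first by rewrite mulrC modp_mul mulrC.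
rewrite modp_small // szq ltnS (leq_trans (size_scale_leq _ _)) //.
exact: size_poly.
Qed.

(* Rows of the Sylvester matrix are reduced modulo the monic [q], i.e., written
   in the basis 1, X, ..., X^(n-1), q, X q, ... *)
Lemma resultant_monic_det (p q : {poly F}) n (M : 'M[F]_n) : q \is monic ->
  size q = n.+1 -> (forall v, rVpoly (v *m M) = (rVpoly v * p) %% q) ->
  resultant p q = \det M.
Proof.
move=> mq szq hM; rewrite /resultant /Sylvester_mx szq /=; set m := (size p).-1.
pose T1 : 'M[F]_(n, n + m) := lin1_mx (poly_rV \o rVpoly).
set Sq : 'M[F]_(m, n + m) := lin1_mx (poly_rV \o q \o* rVpoly).
pose B : 'M[F]_(n, m) := \matrix_i poly_rV (rVpoly (delta_mx 0 i : 'rV_n) * p %/ q).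
have -> : col_mx (lin1_mx (poly_rV \o p \o* rVpoly)) Sq =
          block_mx M B 0 1%:M *m col_mx T1 Sq.
  rewrite mul_block_col mul0mx add0r mul1mx; congr (col_mx _ _).
  apply/row_matrixP => i; rewrite raddfD /= !rowE !mulmxA !mul_rV_lin1 /=.
  rewrite hM -rowE rowK poly_rV_K; last first.
    have [->|nz] := eqVneq (rVpoly (delta_mx 0 i) * p %/ q) 0; first by rewrite size_poly0.
    rewrite size_divp ?monic_neq0 // szq leq_subLR (leq_trans (size_polyMleq _ _)) //.
    have : (size (rVpoly (delta_mx 0%R i : 'rV[F]_n)) <= n)%N by apply: size_poly.
    rewrite /m; case: (size p) => [|k]; rewrite ?addn0 ?addnS /= => le_u.
      by rewrite (leq_trans (leq_pred _)).
    by rewrite leq_add2r.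
  by rewrite -raddfD /= addrC -divp_eq.
(* The second factor is unitriangular: the rows of [Sq] are the X^i q, with the leading coefficient
   of [q] on the diagonal. *)
rewrite det_mulmx det_ublock det1 mulr1 [X in _ * X]det_trig ?big1 ?mulr1 //.
  move=> i _; rewrite mxE; case: splitP => j ij.
    by rewrite !mxE /= rVpoly_delta coefXn ij eqxx.
  rewrite !mxE /= rVpoly_delta coefXnM ij ltnNge leq_addl /= addnK.
  by move/monicP: mq; rewrite lead_coefE szq.
apply/is_trig_mxP => i k ik; rewrite mxE; case: splitP => j ij; move: ik; rewrite ij => ik.
  by rewrite !mxE /= rVpoly_delta coefXn gtn_eqF.
rewrite !mxE /= rVpoly_delta coefXnM; case: ltnP => // jk.
by rewrite nth_default // szq; lia.
Qed.
End Resultant.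

Lemma resultant_prod_roots (F : closedFieldType) (p : {poly F}) (s : seq F) :
  resultant p (\prod_(b <- s) ('X - b%:P)) = \prod_(b <- s) p.[b].
Proof.
set q := \prod_(b <- s) _.
have mq : q \is monic by apply: monic_prod_XsubC.
have szq : size q = (size s).+1 by apply: size_prod_XsubC.
case: s @q mq szq => [|a s] q mq szq.
  have hq : q = 1 by rewrite /q big_nil.
  rewrite (@resultant_monic_det _ p q 0 1%:M) ?det_mx00 ?big_nil // => v.
  by rewrite hq modp1 thinmx0 raddf0.
have := rVpolyM_companion _ mq; have := companionmxK mq.
have szq' : (size q).-1 = (size s).+1 by rewrite szq.
move: (companionmx q); move: (size q).-1 szq' => _ -> C cC hC.
rewrite (resultant_monic_det mq szq (row_horner_companion _ szq hC)).
exact: det_horner_mx cC.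
Qed.

Lemma map_resultant_inj (aR rR : nzRingType) (f : {rmorphism aR -> rR}) (p q : {poly aR}) :
  injective f -> f (resultant p q) = resultant (map_poly f p) (map_poly f q).
Proof.
move=> f_inj; rewrite /resultant /Sylvester_mx !size_map_inj_poly ?rmorph0 //.
rewrite -det_map_mx /= map_col_mx; congr (\det (col_mx _ _));
  by apply: map_lin1_mx => v; rewrite map_poly_rV rmorphM /= map_rVpoly.
Qed.

Lemma Res_roots_r (p q : {poly int}) (t : seq algC) :
  pZtoC q = \prod_(b <- t) ('X - b%:P) ->
  (Res p q)%:R = \prod_(b <- t) `|(pZtoC p).[b]|.
Proof.
move=> Dq; rewrite /Res natr_absz intr_norm.
by rewrite (map_resultant_inj _ _ intr_inj) Dq resultant_prod_roots normr_prod.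
Qed.

(** Both sides are a power of the leading coefficient times the double product of [|z - b|] over the
    roots [z] of [p] and [b] of [q]: the symmetry of the resultant up to sign. *)
Lemma Res_roots_l (p q : {poly int}) (s : seq algC) : q \is monic ->
  pZtoC p = (lead_coef p)%:~R *: \prod_(z <- s) ('X - z%:P) ->
  (Res p q)%:R = `|(lead_coef p)%:~R| ^+ (size q).-1 * \prod_(z <- s) `|(pZtoC q).[z]|.
Proof.
move=> mq Dp; have [t Dt] := closed_field_poly_normal (pZtoC q).
have lq : lead_coef (pZtoC q) = 1.
  by rewrite lead_coef_map_inj //; [rewrite (monicP mq) | exact: intr_inj].
rewrite lq scale1r in Dt.
have szq : size q = (size t).+1.
  by rewrite -(size_prod_XsubC t id) -Dt size_map_inj_poly //; exact: intr_inj.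
rewrite (Res_roots_r _ Dt) szq /= -[_ ^+ _]iter_mulr_1 -(count_predT t) -big_const_seq.
under [X in _ = _ * X]eq_bigr do rewrite Dt horner_prod normr_prod.
rewrite [X in _ = _ * X]exchange_big /= -big_split /=; apply: eq_bigr => b _.
rewrite Dp hornerZ horner_prod normrM normr_prod; congr (_ * _).
by apply: eq_bigr => z _; rewrite !hornerE distrC.
Qed.

Lemma monic_roots (q : {poly int}) : q \is monic ->
  exists t : seq algC, pZtoC q = \prod_(b <- t) ('X - b%:P).
Proof.
move=> mq; have [t Dt] := closed_field_poly_normal (pZtoC q); exists t.
have lq : lead_coef (pZtoC q) = 1.
  by rewrite lead_coef_map_inj //; [rewrite (monicP mq) | exact: intr_inj].
by rewrite lq scale1r in Dt.
Qed.

Lemma ResMl (p1 p2 q : {poly int}) : q \is monic ->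
  Res (p1 * p2) q = (Res p1 q * Res p2 q)%N.
Proof.
move=> /monic_roots [t Dt]; apply/eqP; rewrite -(eqr_nat algC) natrM !(Res_roots_r _ Dt).
rewrite -big_split; apply/eqP; apply: eq_bigr => b _.
by rewrite rmorphM hornerM normrM.
Qed.

Lemma ResMr (p q1 q2 : {poly int}) : q1 \is monic -> q2 \is monic ->
  Res p (q1 * q2) = (Res p q1 * Res p q2)%N.
Proof.
move=> /monic_roots [t1 Dt1] /monic_roots [t2 Dt2]; apply/eqP.
rewrite -(eqr_nat algC) natrM (Res_roots_r _ Dt1) (Res_roots_r _ Dt2) -big_cat.
by rewrite (@Res_roots_r _ _ (t1 ++ t2)) // rmorphM /= Dt1 Dt2 big_cat.
Qed.

(** * Integer sequences with divisible differences *)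

Definition fdiff (f : nat -> int) (m : nat) : int := f m.+1 - f m.

(** An integer substitute for p-adic analyticity. The class is closed under sums and products and
    contains the entries of the powers of a matrix congruent to 1 modulo [q], hence also
    determinants built from such entries. *)
Definition fdiff_dvd (q : int) (f : nat -> int) : Prop :=
  forall j m, (q ^+ j %| iter j fdiff f m)%Z.

Lemma iter_fdiffD j f g :
  iter j fdiff (fun m => f m + g m) = fun m => iter j fdiff f m + iter j fdiff g m.
Proof.
elim: j => //= j ->; apply/funext => m; rewrite /fdiff; ring.
Qed.

Lemma iter_fdiffM j c f :
  iter j fdiff (fun m => c * f m) = fun m => c * iter j fdiff f m.
Proof.
by elim: j => //= j ->; apply/funext => m; rewrite /fdiff mulrBr.
Qed.

(** Induction on [m] with Pascal's rule. The sum runs up to [M] and not [m], so that a single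
    polynomial serves for all arguments up to [M]. *)
Lemma fdiff_newton (f : nat -> int) (M m : nat) : (m <= M)%N ->
  f m = \sum_(j < M.+1) 'C(m, j)%:R * iter j fdiff f 0%N.
Proof.
elim: m M f => [|m IH] M f mM.
  by rewrite big_ord_recl big1 ?addr0 ?mul1r // => i _; rewrite bin0n mul0r.
case: M mM => // M mM; have -> : f m.+1 = f m + fdiff f m by rewrite /fdiff; ring.
rewrite (IH M.+1 f) ?(leqW mM) //; last exact: leqW.
rewrite (IH M (fdiff f)) // [X in X + _ = _]big_ord_recl [in RHS]big_ord_recl !bin0.
rewrite -addrA -big_split /=; congr (_ + _).
by apply: eq_bigr => i _; rewrite /bump /= -iterSr binS natrD mulrDl.
Qed.

Section DiffDivisible.
Variable q : int.
Hypothesis q0 : q != 0.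

Lemma fdiff_dvdD f g : fdiff_dvd q f -> fdiff_dvd q g -> fdiff_dvd q (fun m => f m + g m).
Proof. by move=> hf hg j m; rewrite iter_fdiffD rpredD ?hf ?hg. Qed.

Lemma fdiff_dvdZ c f : fdiff_dvd q f -> fdiff_dvd q (fun m => c * f m).
Proof. by move=> hf j m; rewrite iter_fdiffM dvdz_mull ?hf. Qed.

Lemma fdiff_dvd_fdiff f : fdiff_dvd q f ->
  exists2 f', fdiff_dvd q f' & fdiff f = fun m => q * f' m.
Proof.
move=> hf; exists (fun m => (fdiff f m %/ q)%Z).
  move=> j m; rewrite -(dvdz_mul2l q0) -exprS.
  have -> : q * iter j fdiff (fun m => (fdiff f m %/ q)%Z) m =
            iter j fdiff (fdiff f) m.
    rewrite -[LHS]/((fun m => _) m) -iter_fdiffM; congr (iter j fdiff _ m).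
    apply/funext => i; rewrite mulrC divzK //; exact: (hf 1%N).
  by rewrite -iterSr.
by apply/funext => i; rewrite mulrC divzK //; exact: (hf 1%N).
Qed.

(** Leibniz rule: if the differences of [f] and [g] are [q f'] and [q g'], that of [f g] is
    [q (f' g + f g' + q f' g')]. A factor [q] comes out, and the products left have one difference
    less to take. *)
Lemma fdiff_dvdM f g : fdiff_dvd q f -> fdiff_dvd q g -> fdiff_dvd q (fun m => f m * g m).
Proof.
move=> hf hg j; elim: j f g hf hg => [|j IH] f g hf hg m; first by rewrite dvd1z.
have [f' hf' Df] := fdiff_dvd_fdiff hf; have [g' hg' Dg] := fdiff_dvd_fdiff hg.
have -> : iter j.+1 fdiff (fun m => f m * g m) m =
    q * iter j fdiff (fun m => f' m * g m + (f m * g' m + q * (f' m * g' m))) m.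
  rewrite iterSr -[RHS]/((fun m => _) m) -iter_fdiffM; congr (iter j fdiff _ m).
  apply/funext => i; have := congr1 (@^~ i) Df; have := congr1 (@^~ i) Dg.
  rewrite /fdiff => /eqP; rewrite subr_eq => /eqP -> /eqP; rewrite subr_eq => /eqP ->.
  by ring.
rewrite exprS dvdz_mul2l // !iter_fdiffD iter_fdiffM.
by rewrite !rpredD ?IH // dvdz_mull ?IH.
Qed.

Lemma fdiff_dvd_cst c : fdiff_dvd q (fun=> c).
Proof.
have H j : iter j.+1 fdiff (fun=> c) = fun=> 0.
  elim: j => [|j IH]; first by apply/funext => m; rewrite /= /fdiff subrr.
  by apply/funext => m; rewrite iterS IH /fdiff subrr.
by case=> [|j] m; rewrite ?H ?dvdz0 // dvd1z.
Qed.

Lemma fdiff_dvd_sum I (r : seq I) (P : pred I) (F : I -> nat -> int) :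
  (forall i, fdiff_dvd q (F i)) -> fdiff_dvd q (fun m => \sum_(i <- r | P i) F i m).
Proof.
move=> hF; elim: r => [|i r IH].
  by under [X in fdiff_dvd _ X]funext do rewrite big_nil; apply: fdiff_dvd_cst.
under [X in fdiff_dvd _ X]funext do rewrite big_cons.
by case: (P i) => //; apply: fdiff_dvdD.
Qed.

Lemma fdiff_dvd_prod I (r : seq I) (P : pred I) (F : I -> nat -> int) :
  (forall i, fdiff_dvd q (F i)) -> fdiff_dvd q (fun m => \prod_(i <- r | P i) F i m).
Proof.
move=> hF; elim: r => [|i r IH].
  by under [X in fdiff_dvd _ X]funext do rewrite big_nil; apply: fdiff_dvd_cst.
under [X in fdiff_dvd _ X]funext do rewrite big_cons.
by case: (P i) => //; apply: fdiff_dvdM.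
Qed.

Lemma fdiff_dvd_det n (A : nat -> 'M[int]_n) :
  (forall i j, fdiff_dvd q (fun m => A m i j)) -> fdiff_dvd q (fun m => \det (A m)).
Proof.
move=> hA; apply: fdiff_dvd_sum => s; apply: fdiff_dvdZ; exact: fdiff_dvd_prod.
Qed.

(** Since [(1 + y) ^+ m.+1 - (1 + y) ^+ m = y * (1 + y) ^+ m], each difference inserts one factor
    [y]. The additive map [phi] stands for reading off a matrix entry. *)
Lemma iter_fdiff_exp (S : nzRingType) (phi : S -> int) (x y : S) j m :
  {morph phi : u v / u - v} ->
  iter j fdiff (fun m => phi (x * (1 + y) ^+ m)) m = phi (x * y ^+ j * (1 + y) ^+ m).
Proof.
move=> hphi; elim: j m => [|j IH] m /=; first by rewrite expr0 mulr1.
rewrite /fdiff !IH -hphi; congr phi; rewrite exprS mulrDl mul1r mulrDr addrC addKr.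
by rewrite exprSr !mulrA.
Qed.

Lemma fdiff_dvd_exp_mx n (A B : 'M[int]_n.+1) i j :
  fdiff_dvd q (fun m => (A * (1 + q *: B) ^+ m) i j).
Proof.
move=> k m; rewrite (@iter_fdiff_exp _ (fun M : 'M[int]_n.+1 => M i j)) => [|u v]; last first.
  by rewrite !mxE.
by rewrite exprZn -scalerAr -scalerAl mxE dvdz_mulr.
Qed.

Lemma fdiff_dvd_exp (a b : int) : fdiff_dvd q (fun m => a * (1 + q * b) ^+ m).
Proof.
move=> k m; rewrite (@iter_fdiff_exp _ id) //.
by rewrite exprMn mulrCA -mulrA dvdz_mulr.
Qed.

End DiffDivisible.

(** Legendre's formula, where the term [n %/ p ^ k] at least halves when [k] grows by 1. Counting
    the last term twice makes the induction work. *)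
Lemma logn_fact_leq p n : prime p -> (logn p n`! <= n)%N.
Proof.
move=> pp; rewrite logn_fact //.
suff H m : (\sum_(1 <= k < m.+1) n %/ p ^ k + n %/ p ^ m <= n)%N.
  exact: leq_trans (leq_addr _ _) (H n).
elim: m => [|m IH]; first by rewrite big_geq // expn0 divn1.
rewrite big_nat_recr //=; apply: leq_trans IH; rewrite -addnA leq_add2l.
rewrite expnSr divnMA addnn -muln2; apply: leq_trans (leq_trunc_div _ p).
by rewrite leq_mul2l prime_gt1 ?orbT.
Qed.

Definition ffpoly (j : nat) : {poly int} := \prod_(i < j) ('X - i%:R%:P).

Lemma size_ffpoly j : size (ffpoly j) = j.+1.
Proof. by rewrite /ffpoly size_prod_XsubC /index_enum -enumT size_enum_ord. Qed.

Lemma horner_ffpoly j m : (ffpoly j).[m%:R] = (m ^_ j)%:R.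
Proof.
elim: j => [|j IH]; first by rewrite /ffpoly big_ord0 hornerC ffactn0.
rewrite /ffpoly big_ord_recr /= hornerM IH !hornerE ffactnSr natrM.
have [mj|jm] := ltnP m j; first by rewrite ffact_small ?mul0r.
by rewrite natrB.
Qed.

(** Divide [Hi] by the monic polynomial [Z] with roots [s]. With the remainder [R], [Lo + d *: R]
    has degree below [size s] and still vanishes on [s], so it is 0; what is left is [d] times an
    integer polynomial. *)
Lemma dvdz_horner_roots (d : int) (Lo Hi : {poly int}) (s : seq int) (x : int) :
  uniq s -> (size Lo <= size s)%N -> all (root (Lo + d *: Hi)) s ->
  (d %| (Lo + d *: Hi).[x])%Z.
Proof.
move=> us szL rs; pose Z := \prod_(b <- s) ('X - b%:P).
have mZ : Z \is monic by apply: monic_prod_XsubC.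
have rZ b : b \in s -> root Z b by rewrite root_prod_XsubC.
have E := Pdiv.RingMonic.rdivp_eq mZ Hi.
set V := Pdiv.Ring.rdivp Hi Z in E; set R := Pdiv.Ring.rmodp Hi Z in E.
have : Lo + d *: R = 0.
  apply: contraTeq isT => nz.
  have := max_poly_roots nz _ us; rewrite ltnNge.
  have -> : (size (Lo + d *: R)%R <= size s)%N.
    rewrite (leq_trans (size_polyD _ _)) // geq_max szL (leq_trans (size_scale_leq _ _)) //.
    by rewrite -ltnS -(size_prod_XsubC s id) Pdiv.Ring.ltn_rmodpN0 ?monic_neq0.
  apply; apply/allP => b bs; have := allP rs b bs; rewrite /root E !hornerE.
  by rewrite (rootP (rZ _ bs)) mulr0 add0r.
rewrite {1}E scalerDr addrCA => ->.
by rewrite addr0 hornerZ dvdz_mulr.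
Qed.

(* Since v_p(j!) <= j, the [j]-th Newton term p^(2j) 'C(m, j) of [f] is p^j times an
   integer polynomial, up to a denominator prime to [p] cleared by [w].  Modulo p^T
   the resulting polynomial has degree < T, and [s] provides T roots. *)
Lemma fdiff_dvd_zeros_dvd (p : nat) (f : nat -> int) (s : seq nat) (m : nat) : prime p ->
  fdiff_dvd (p ^ 2)%N f -> uniq s -> {in s, forall i, f i = 0} ->
  ((p ^ size s)%N %| f m)%Z.
Proof.
move=> pp hf us fs.
(* [M] bounds [m] and all zeros in [s]. The part [w] of M! prime to [p] is a multiple of the
   corresponding part of every j! with [j <= M], and it can be cancelled at the end. *)
pose M := (m + \sum_(i <- s) i)%N; pose w : nat := M`!`_p^'.
have le_sM i : i \in s -> (i <= M)%N.
  move=> si; rewrite /M (big_rem i) //=; lia.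
have coef j : (j <= M)%N -> exists e : int, forall i,
    w%:R * ('C(i, j)%:R * iter j fdiff f 0%N) = p%:R ^+ j * e * (i ^_ j)%:R.
  move=> jM; have /dvdzP [d ->] := hf j 0%N.
  have [t Dt] : exists t, w = (t * j`!`_p^')%N.
    apply/dvdnP; apply: partn_dvd; rewrite ?fact_gt0 //.
    by rewrite (fact_split jM) dvdn_mulr.
  exists (t%:R * p%:R ^+ (j - logn p j`!) * d) => i.
  have Dj : (j`!)%:R = p%:R ^+ logn p j`! * (j`!`_p^')%:R :> int.
    by rewrite -[in LHS](partnC p (fact_gt0 j)) p_part natrM natrX.
  rewrite -bin_ffact Dt !natrM Dj.
  have -> : ((p ^ 2)%N : int) ^+ j = p%:R ^+ j * p%:R ^+ (j - logn p j`!) * p%:R ^+ logn p j`!.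
    by rewrite -mulrA -exprD subnK ?logn_fact_leq // -natz natrX -exprM mul2n -addnn exprD.
  by ring.
have /choice [e He] (j : 'I_M.+1) := coef j (leq_ord j).
pose c (j : 'I_M.+1) : {poly int} := (p%:R ^+ j * e j) *: ffpoly j.
have hor i : (i <= M)%N -> (\sum_(j < M.+1) c j).[i%:R] = w%:R * f i.
  move=> iM; rewrite (fdiff_newton f iM) mulr_sumr horner_sum; apply: eq_bigr => j _.
  by rewrite He hornerZ horner_ffpoly.
pose T := size s.
pose Lo := \sum_(j < M.+1 | (j < T)%N) c j.
pose Hi := \sum_(j < M.+1 | ~~ (j < T)%N) (p%:R ^+ (j - T) * e j) *: ffpoly j.
have split : \sum_(j < M.+1) c j = Lo + (p%:R ^+ T : int) *: Hi.
  rewrite (bigID (fun j : 'I_M.+1 => (j < T)%N)) /= scaler_sumr; congr (_ + _).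
  apply: eq_bigr => j; rewrite -leqNgt => Tj.
  by rewrite scalerA mulrA -exprD subnKC.
have : ((p ^ T)%N %| w%:R * f m)%Z.
  have mM : (m <= M)%N by rewrite leq_addr.
  have -> : ((p ^ T)%N : int) = p%:R ^+ T by rewrite -natrX natz.
  rewrite -hor // split; apply: (@dvdz_horner_roots _ _ _ [seq (i%:R : int) | i <- s]).
  - by rewrite map_inj_uniq // => i j /eqP; rewrite eqr_nat => /eqP.
  - rewrite size_map; apply: leq_trans (size_sum _ _ _) _; apply/bigmax_leqP => j jT.
    by rewrite (leq_trans (size_scale_leq _ _)) // size_ffpoly.
  - by apply/allP => _ /mapP [i si ->]; rewrite -split /root hor ?le_sM // fs // mulr0.
rewrite !dvdzE abszM natz !absz_nat Gauss_dvdr // coprimeXl //.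
by apply: (@pnat_coprime p); rewrite ?pnat_id // part_pnat.
Qed.

(** With at least [|f m0|] zeros, [f m0] would be divisible by a power of [p] larger than itself. *)
Lemma fdiff_dvd_zeros_finite (p : nat) (f : nat -> int) (m0 : nat) : prime p ->
  fdiff_dvd (p ^ 2)%N f -> f m0 != 0 -> finite_set [set m | f m = 0].
Proof.
move=> pp hf fm0; apply: contrapT => inf.
have [B BA sB] := infinite_set_fset `|f m0|%N inf.
have := @fdiff_dvd_zeros_dvd p f (finmap.enum_fset B) m0 pp hf (finmap.fset_uniq B).
rewrite dvdzE absz_nat => /(_ (fun i iB => BA i iB)) /dvdn_leq.
rewrite absz_gt0 fm0 leqNgt => /(_ isT) /negP; apply.
exact: leq_ltn_trans sB (ltn_expl _ (prime_gt1 pp)).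
Qed.

(** * Dirichlet approximation and growth *)

Lemma truncn_close (x y : algC) : 0 <= x -> 0 <= y ->
  Num.truncn x = Num.truncn y -> `|x - y| < 1.
Proof.
move=> x0 y0 E; have /andP [x1 x2] := truncn_itv x0; have /andP [y1 y2] := truncn_itv y0.
rewrite -E -natr1 in y1 y2; rewrite -natr1 in x2.
rewrite real_ltr_norml ?rpredB ?ger0_real // ltrNl opprB !ltrBlDl.
by rewrite (lt_le_trans y2) ?(lt_le_trans x2) // lerD2r.
Qed.

(** Pigeonhole principle for the powers of [z] in small square boxes. It matters for [dirichlet_seq]
    that [T] does not depend on [z]. *)
Lemma dirichlet_unit (e : algC) : 0 < e ->
  exists T : nat, forall z : algC, `|z| = 1 ->
  exists t, [/\ (0 < t)%N, (t <= T)%N & `|z ^+ t - 1| <= e].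
Proof.
move=> e0; have e20 : 0 <= 2 / e by rewrite divr_ge0 // ltW.
(* Shifted by 1 and scaled by [K], real and imaginary parts lie in [0, 2K], ends included, hence 2K
   + 1 boxes per axis. Two points of a box are at distance at most 2/K, hence at most [e]. *)
pose K := (Num.bound (2 / e)).+1; pose N := ((2 * K).+1 * (2 * K).+1)%N.
exists N => z z1.
have K0 : 0 < K%:R :> algC by rewrite ltr0n.
have eK : 2 <= e * K%:R.
  rewrite mulrC -ler_pdivrMr // ltW // (lt_le_trans (archi_boundP e20)) //.
  by rewrite ler_nat.
have ge0 (x : algC) : x \is Num.real -> `|x| <= 1 -> 0 <= (x + 1) * K%:R.
  move=> xr; rewrite real_ler_norml // => /andP [x1 _].
  by rewrite mulr_ge0 ?ler0n // -lerBlDr sub0r.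
have boxP (x : algC) : x \is Num.real -> `|x| <= 1 ->
    (Num.truncn ((x + 1) * K%:R) < (2 * K).+1)%N.
  move=> xr x1; rewrite truncn_lt_nat; last exact: ge0.
  move: x1; rewrite real_ler_norml // => /andP [_ x1].
  rewrite (@le_lt_trans _ _ (2 * K)%:R) ?ltr_nat // natrM ler_pM2r //.
  by rewrite -[2]/(1 + 1)%:R natrD lerD2r.
have normX t : `|z ^+ t| = 1 by rewrite normrX z1 expr1n.
have normRe (x : algC) : `|x| = 1 -> `|'Re x| <= 1.
  by move=> <-; exact: (leif_normC_Re_Creal x).1.
have normIm (x : algC) : `|x| = 1 -> `|'Im x| <= 1.
  move=> <-; rewrite -(@ler_pXn2r _ 2) ?nnegrE // (normC2_Re_Im x).
  by rewrite real_normK ?Creal_Im // lerDr -realEsqr Creal_Re.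
pose box (t : 'I_N.+1) : 'I_(2 * K).+1 * 'I_(2 * K).+1 :=
  (inord (Num.truncn (('Re (z ^+ t) + 1) * K%:R)),
   inord (Num.truncn (('Im (z ^+ t) + 1) * K%:R))).
have : ~~ injectiveb box.
  apply/negP => /injectiveP /leq_card; rewrite card_prod !card_ord -/N.
  by rewrite ltnn.
case/injectivePn => i [j ij [Ere Eim]].
wlog lt_ij : i j ij Ere Eim / (i < j)%N.
  move=> H; have : (i : nat) != j by [].
  by rewrite neq_ltn => /orP [] lt; [apply: (H i j) | apply: (H j i); rewrite // eq_sym].
exists (j - i)%N; rewrite subn_gt0 lt_ij; split=> //.
  by rewrite (leq_trans (leq_subr _ _)) // -ltnS.
have -> : `|z ^+ (j - i) - 1| = `|z ^+ j - z ^+ i|.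
  have -> : z ^+ j = z ^+ i * z ^+ (j - i) by rewrite -exprD subnKC // ltnW.
  by rewrite -[z ^+ i in X in _ = `|_ - X|]mulr1 -mulrBr normrM normX mul1r.
have close (x y : algC) : x \is Num.real -> y \is Num.real -> `|x| <= 1 -> `|y| <= 1 ->
    inord (Num.truncn ((x + 1) * K%:R)) = inord (Num.truncn ((y + 1) * K%:R)) :> 'I_(2 * K).+1 ->
    `|y - x| * K%:R <= 1.
  move=> xr yr x1 y1 /(congr1 val); rewrite /= (inordK (boxP _ xr x1)).
  rewrite (inordK (boxP _ yr y1)) => E.
  have := truncn_close (ge0 _ yr y1) (ge0 _ xr x1) (esym E).
  rewrite -mulrBl opprD addrACA subrr addr0 normrM [`|K%:R|]ger0_norm ?ler0n //; exact: ltW.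
rewrite -(ler_pM2r K0) (le_trans _ eK) //.
rewrite [z ^+ j]Crect [z ^+ i]Crect opprD addrACA -mulrBr.
rewrite (le_trans (ler_wpM2r (ltW K0) (ler_normD _ _))) // normrM normCi mul1r mulrDl.
rewrite -[2]/(1 + 1)%:R natrD lerD //; apply: close => //;
  by rewrite ?Creal_Re ?Creal_Im ?normRe ?normIm.
Qed.

(** A [t] that suits the tail with error [e / T.+1] is multiplied by some [u <= T] that suits
    [z ^+ t]; taking [u]-th powers on the unit circle enlarges the other errors at most [u]
    times. *)
Lemma dirichlet_seq (s : seq algC) (e : algC) : 0 < e -> {in s, forall z, `|z| = 1} ->
  exists2 t, (0 < t)%N & {in s, forall z, `|z ^+ t - 1| <= e}.
Proof.
elim: s e => [|z s IH] e e0 s1; first by exists 1%N.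
have [T HT] := dirichlet_unit e0.
have e'0 : 0 < e / T.+1%:R by rewrite divr_gt0 ?ltr0n.
have [|t t0 Ht] := IH _ e'0; first by move=> w ws; rewrite s1 // inE ws orbT.
have zt1 : `|z ^+ t| = 1 by rewrite normrX s1 ?mem_head // expr1n.
have [u [u0 uT Hu]] := HT _ zt1.
exists (t * u)%N; first by rewrite muln_gt0 t0.
move=> w; rewrite inE exprM => /orP [/eqP ->//|ws].
have w1 : `|w ^+ t| = 1 by rewrite normrX s1 ?expr1n // inE ws orbT.
rewrite subrX1 normrM (le_trans (ler_wpM2r _ (Ht w ws))) //.
rewrite mulrAC ler_pdivrMr ?ltr0n // ler_pM2l // (le_trans (ler_norm_sum _ _ _)) //.
under eq_bigr do rewrite normrX w1 expr1n.
by rewrite sumr_const card_ord ler_nat (leq_trans uT).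
Qed.

Lemma pos_lower_bound (I : eqType) (s : seq I) (g : I -> algC) : {in s, forall i, 0 < g i} ->
  exists2 d : algC, 0 < d & {in s, forall i, d <= g i}.
Proof.
elim: s => [|i s IH] gs; first by exists 1.
(* [algC] is only partially ordered; instead of a minimum, [d * g i / (d + g i)] is a positive
   number below both [d] and [g i]. *)
have [j js|d d0 Hd] := IH; first by rewrite gs // inE js orbT.
have gi := gs i (mem_head _ _); exists (d * g i / (d + g i)).
  by rewrite divr_gt0 ?mulr_gt0 ?addr_gt0.
move=> j; rewrite ler_pdivrMr ?addr_gt0 // inE => /orP [/eqP -> | js].
  by rewrite mulrDr mulrC lerDl ltW ?mulr_gt0.
rewrite mulrDr (le_trans (ler_wpM2r (ltW gi) (Hd _ js))) // lerDr ltW ?mulr_gt0 //.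
by rewrite gs // inE js orbT.
Qed.

Lemma prod_ge_factor (I : eqType) (s : seq I) (g : I -> algC) i :
  {in s, forall j, 1 <= g j} -> i \in s -> g i <= \prod_(j <- s) g j.
Proof.
move=> gs si; rewrite (big_rem i) //= ler_peMr ?(le_trans ler01) ?gs // big_seq.
by elim/big_ind: _ => // [x y|j /mem_rem]; [exact: mulr_ege1 | exact: gs].
Qed.

Lemma prod_le_factor (I : eqType) (s : seq I) (g : I -> algC) i :
  {in s, forall j, 0 <= g j <= 1} -> i \in s -> \prod_(j <- s) g j <= g i.
Proof.
move=> gs si; have /andP [gi _] := gs i si.
rewrite (big_rem i) //= ler_piMr // big_seq.
by apply: prodr_ile1 => j /mem_rem; exact: gs.
Qed.

Lemma exp_unbounded (M d : algC) (B : nat) : 1 < M -> 0 < d ->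
  exists L, forall n, (L <= n)%N -> B%:R < d * M ^+ n.
Proof.
move=> M1 d0; have M0 : 0 < M - 1 by rewrite subr_gt0.
have x0 : 0 <= B%:R / (d * (M - 1)) by rewrite divr_ge0 ?ler0n ?mulr_ge0 ?ltW.
exists (Num.bound (B%:R / (d * (M - 1)))) => n Ln.
have Mn : n%:R * (M - 1) < M ^+ n.
  elim: n {Ln} => [|n IH]; first by rewrite mul0r expr0.
  rewrite exprS -natr1 mulrDl mul1r -[X in _ < X * _](subrK 1) mulrDl mul1r addrC.
  rewrite ler_ltD // ler_peMr ?(ltW M0) // exprn_ege1 // ltW //.
rewrite -ltr_pdivrMl // (le_lt_trans _ Mn) // -ler_pdivrMr //.
have -> : d^-1 * B%:R / (M - 1) = B%:R / (d * (M - 1)) by rewrite invfM; ring.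
by rewrite ltW // (lt_le_trans (archi_boundP x0)) // ler_nat.
Qed.

Lemma exp_sub1_lower (s : seq algC) (r N : nat) : (0 < r)%N -> (0 < N)%N ->
  {in s, forall z, forall n, (0 < n)%N -> z ^+ n != 1} ->
  exists2 d : algC, 0 < d & forall L, exists2 m, (L <= m)%N &
    {in s, forall z, d * Num.max 1 `|z| ^+ (r + N * m) <= `|z ^+ (r + N * m) - 1|}.
Proof.
move=> r0 N0 hs.
(* On the unit circle, [z ^+ n] will be near [z ^+ r], and half the distance of [z ^+ r] from 1
   remains. Elsewhere the triangle inequality suffices for every positive exponent. *)
pose g (z : algC) := if `|z| == 1 then `|z ^+ r - 1| / 2 else
  if 1 < `|z| then 1 - `|z|^-1 else 1 - `|z|.
have gs : {in s, forall z, 0 < g z}.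
  move=> z zs; rewrite /g; case: eqP => [_|/eqP z1].
    by rewrite divr_gt0 // normr_gt0 subr_eq0 hs.
  case: (real_ltP (real1 _) (normr_real z)) => z1'.
    by rewrite subr_gt0 invf_lt1 // (lt_trans ltr01).
  by rewrite subr_gt0 lt_neqAle z1.
have [d d0 Hd] := pos_lower_bound gs.
exists d => // L.
(* The exponent [N * L.+1] makes [m] a positive multiple of [L.+1], hence arbitrarily large. *)
have [|t t0 Ht] := @dirichlet_seq [seq z ^+ (N * L.+1) | z <- s & `|z| == 1] _ d0.
  by move=> y /mapP [z]; rewrite mem_filter => /andP [/eqP z1 _] ->; rewrite normrX z1 expr1n.
exists (L.+1 * t)%N; first by rewrite (leq_trans _ (leq_pmulr _ t0)).
set n := (r + _)%N => z zs; have n0 : (0 < n)%N by rewrite addn_gt0 r0.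
have := Hd z zs; rewrite /g; case: eqP => [z1|/eqP z1].
  have /Ht : z ^+ (N * L.+1) \in [seq z ^+ (N * L.+1) | z <- s & `|z| == 1].
    by apply/mapP; exists z; rewrite // mem_filter z1 eqxx.
  rewrite -exprM -mulnA z1 maxxx expr1n mulr1 ler_pdivlMr // => h1 h2.
  have -> : z ^+ n - 1 = (z ^+ r - 1) - (z ^+ r - z ^+ n) by ring.
  apply: le_trans (lerB_dist _ _); rewrite lerBrDr (le_trans _ h2) // mulr2n mulrDr mulr1.
  rewrite lerD2l /n exprD -[X in `|X - _|]mulr1 -mulrBr normrM normrX z1 expr1n mul1r.
  by rewrite distrC.
rewrite /Num.max; case: (real_ltP (real1 _) (normr_real z)) => z1' dz.
  have z0 : 0 < `|z| by rewrite (lt_trans ltr01).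
  apply: le_trans (lerB_dist _ _); rewrite normr1 normrX.
  apply: le_trans (ler_wpM2r _ dz) _; first by rewrite exprn_ge0.
  rewrite mulrBl mul1r lerD2l lerN2 -(prednK n0) exprS mulKf ?gt_eqF //.
  by rewrite exprn_ege1 // ltW.
rewrite expr1n mulr1 (le_trans dz) // distrC.
apply: le_trans (lerB_dist _ _); rewrite normr1 normrX lerD2l lerN2.
by rewrite -(prednK n0) exprS ler_piMr // exprn_ile1.
Qed.

(* Kronecker's theorem comes for free: if the Mahler measure is 1, all [z] lie on
   the unit circle and Dirichlet makes the integer [A ^+ n * prod] less than 1. *)
Lemma norm_prod_unbounded (s : seq algC) (A : algC) : s != [::] -> 1 <= A ->
  1 <= A * \prod_(z <- s) `|z| ->
  (forall n, (0 < n)%N -> 1 <= A ^+ n * \prod_(z <- s) `|z ^+ n - 1|) ->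
  forall r N B : nat, (0 < r)%N -> (0 < N)%N ->
  exists m, B%:R < A ^+ (r + N * m) * \prod_(z <- s) `|z ^+ (r + N * m) - 1|.
Proof.
move=> s0 A1 AP int r N B r0 N0.
have A0 : 0 < A := lt_le_trans ltr01 A1.
have hs : {in s, forall z, forall n, (0 < n)%N -> z ^+ n != 1}.
  move=> z zs n n0; apply: contraTneq (int n n0) => zn.
  by rewrite (big_rem z) //= zn subrr normr0 mul0r mulr0 ler10.
have max1 (z : algC) : 1 <= Num.max 1 `|z|.
  rewrite /Num.max; case: ifP => // ; exact: ltW.
(* The Mahler measure of the polynomial with leading coefficient [A] and roots [s]. *)
pose M := A * \prod_(z <- s) Num.max 1 `|z|.
have P1 : 1 <= \prod_(z <- s) Num.max 1 `|z|.
  by elim/big_ind: _ => // x y; exact: mulr_ege1.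
have [M1|M1] : 1 < M \/ (A = 1 /\ {in s, forall z, `|z| <= 1}).
  have [A1'|A1'] := eqVneq A 1; last first.
    left; apply: (@lt_le_trans _ _ A); first by rewrite lt_neqAle eq_sym A1'.
    by rewrite ler_peMr // ltW.
  have [/hasP [z zs z1]|/hasPn hz] := boolP (has (fun z => 1 < `|z|) s).
    left; apply: lt_le_trans z1 _; rewrite /M A1' mul1r.
    apply: le_trans (prod_ge_factor _ zs) => //=.
    rewrite /Num.max; case: ifP => // /negbT; rewrite -real_leNgt //.
  right; split=> // z zs; have := hz z zs; by rewrite -real_leNgt.
  have [d d0 Hd] := exp_sub1_lower r0 N0 hs.
  have [L HL] := exp_unbounded B M1 (exprn_gt0 (size s) d0).
  have [m Lm Hm] := Hd L; exists m; set n := (r + _)%N in Hm *.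
  have Ln : (L <= n)%N by rewrite (leq_trans Lm) // /n; nia.
  apply: lt_le_trans (HL n Ln) _; rewrite exprMn mulrCA ler_pM2l ?exprn_gt0 //.
  rewrite -[d ^+ _]iter_mulr_1 -(count_predT s) -big_const_seq -prodrXl -big_split /=.
  rewrite big_seq [leRHS]big_seq; apply: ler_prod => z zs.
  by rewrite Hm // mulr_ge0 ?exprn_ge0 ?(ltW d0) // (le_trans ler01).
case: M1 => A1' hle; rewrite A1' mul1r in AP.
have h1 : {in s, forall z, `|z| = 1}.
  move=> z zs; apply/eqP; rewrite eq_le hle //= (le_trans AP) //.
  by apply: (prod_le_factor _ zs) => w ws; rewrite normr_ge0 hle.
(* With error 1/2, one factor is at most 1/2 and the others are at most 1, contrary to the lower
   bound [int]. *)
have h0 : 0 < 2^-1 :> algC by rewrite invr_gt0.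
have [t t0 Ht] := dirichlet_seq h0 h1.
have := int t t0; rewrite A1' expr1n mul1r real_leNgt ?rpred_prod //; last first.
  by move=> z _; apply: normr_real.
case: s s0 Ht {AP int hs P1 M hle h1} => // z s _ Ht /negP []; rewrite big_cons.
apply: le_lt_trans (_ : 2^-1 < 1); last by rewrite invf_lt1 // ltr1n.
rewrite -[leRHS]mulr1; apply: ler_pM; rewrite ?normr_ge0 ?prodr_ge0 ?Ht ?mem_head //.
rewrite big_seq; apply: prodr_ile1 => w ws; rewrite normr_ge0 (le_trans (Ht w _)) ?inE ?ws ?orbT //.
by rewrite invf_le1 // ler1n.
Qed.

(** * Finiteness for [t^n - 1] *)

Lemma intr_Zp_eq0 (q : nat) (x : int) : (1 < q)%N -> (x%:~R == 0 :> 'Z_q) = (q %| x)%Z.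
Proof.
move=> q1; have H n : (n%:R == 0 :> 'Z_q) = (q %| n)%N.
  by rewrite -val_eqE /= val_Zp_nat.
by rewrite dvdzE absz_nat; case: x => n; rewrite ?NegzE ?mulrNz ?oppr_eq0 ?abszN; exact: H.
Qed.

(** [N] is the order of [M] in the finite unit group of matrices modulo [q]. The factor [k] permits
    a common exponent for two matrices. *)
Lemma exp_mx_mod (n q : nat) (M : 'M[int]_n.+1) : (1 < q)%N -> coprime q `|\det M|%N ->
  exists2 N, (0 < N)%N & forall k, exists B : 'M[int]_n.+1, M ^+ (N * k) = 1 + q%:Z *: B.
Proof.
move=> q1 cop; pose Mq : 'M['Z_q]_n.+1 := map_mx intr M.
have uM : Mq \is a GRing.unit.
  rewrite -[_ \is a GRing.unit]/(Mq \in unitmx) unitmxE det_map_mx.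
  have := cop; rewrite -unitZpE //.
  by case: (\det M) => m //; rewrite NegzE abszN => um; rewrite rmorphN unitrN.
pose u : {unit 'M['Z_q]_n.+1} := FinRing.Unit uM.
exists #[u]%g => [|k]; first exact: order_gt0.
have E : map_mx intr (M ^+ (#[u]%g * k)) = 1 :> 'M['Z_q]_n.+1.
  rewrite -[LHS]/(map_mx _ _) rmorphXn /= exprM.
  by rewrite -[map_mx _ M]/(val u) -FinRing.val_unitX expg_order /= expr1n.
exists (\matrix_(i, j) ((M ^+ (#[u]%g * k) - 1) i j %/ q)%Z).
rewrite -[LHS](subrK 1) addrC; congr (_ + _); apply/matrixP => i j.
rewrite [RHS]mxE [in RHS]mxE mulrC divzK // -intr_Zp_eq0 //.
have := congr1 (fun A : 'M_n.+1 => A i j) E; rewrite !mxE rmorphB /= => ->.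
by rewrite rmorph_nat subrr.
Qed.

(** Powers of [a] stand on both sides to avoid the truncated exponent [size s - i]. *)
Lemma coef_prod_scaled_roots (R : comNzRingType) (s : seq R) (a : R) i :
  a ^+ i * (\prod_(z <- s) ('X - (a * z)%:P))`_i =
  a ^+ size s * (\prod_(z <- s) ('X - z%:P))`_i.
Proof.
elim: s i => [|z s IH] i.
  rewrite !big_nil !coefC; case: i => [|i] /=; rewrite ?expr0 ?mulr0 //.
rewrite !big_cons !mulrBl !coefB !coefXM !coefCM /=.
move: (\prod_(z <- s) ('X - (a * z)%:P)) (\prod_(z <- s) ('X - z%:P)) IH => P Q IH.
case: i => [|i] /=; first by have := IH 0%N; rewrite !expr0 !mul1r => ->; rewrite exprS; ring.
transitivity (a * (a ^+ i * P`_i) - a * z * (a ^+ i.+1 * P`_i.+1)); first by rewrite exprS; ring.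
by rewrite !IH exprS; ring.
Qed.

(** [H] is a^d h(X / a): it is monic and integral, and its roots are the [a z]. [C] is its companion
    matrix, with determinant the constant coefficient of [H] up to sign. *)
Lemma scaled_companion (h : {poly int}) (s : seq algC) d (a := lead_coef h) :
  size h = d.+2 -> pZtoC h = a%:~R *: \prod_(z <- s) ('X - z%:P) ->
  exists2 C : 'M[int]_d.+1,
    pZtoC (char_poly C) = \prod_(z <- s) ('X - (a%:~R * z)%:P) &
    `|\det C|%N = (`|(h`_0)%R| * `|a| ^ d)%N.
Proof.
(* The top coefficient is set apart: at [i = d.+1] the truncated [d - i] is 0, and the general
   formula would give [a] instead of 1. *)
move=> szh Dh; pose H := \poly_(i < d.+2) (if i == d.+1 then 1 else h`_i * a ^+ (d - i)).
have a0 : a != 0 by rewrite lead_coef_eq0 -size_poly_eq0 szh.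
have aC0 : a%:~R != 0 :> algC by rewrite intr_eq0.
have szH : size H = d.+2 by rewrite size_poly_eq // eqxx oner_neq0.
have mH : H \is monic by rewrite monicE lead_coefE szH coef_poly eqxx ltnSn.
have szs : size s = d.+1.
  have := size_prod_XsubC s id; rewrite -(size_scale _ aC0) -Dh size_map_inj_poly ?szh //.
    by case.
  exact: intr_inj.
have DH : pZtoC H = \prod_(z <- s) ('X - (a%:~R * z)%:P).
  set Q := \prod_(z <- s) _; have szQ : size Q = d.+2 by rewrite size_prod_XsubC szs.
  apply/polyP => i; rewrite coef_map coef_poly; case: ltnP => [id|di]; last first.
    by rewrite nth_default // szQ.
  have [->|id1] := eqVneq i d.+1.
    have : Q \is monic by apply: monic_prod_XsubC.
    by rewrite monicE lead_coefE szQ => /eqP ->.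
  have id2 : (i <= d)%N by rewrite -ltnS ltn_neqAle id1 -ltnS.
  apply: (mulfI (expf_neq0 i aC0)); rewrite coef_prod_scaled_roots szs exprS -mulrA.
  have := congr1 (fun p : {poly algC} => p`_i) Dh; rewrite coef_map coefZ /= => Ei.
  rewrite mulrCA -Ei rmorphM rmorphXn /= mulrCA -exprD subnKC //; exact: mulrC.
have [C cC] : exists C : 'M[int]_d.+1, char_poly C = H.
  have := companionmxK mH; move: (companionmx H); have : (size H).-1 = d.+1 by rewrite szH.
  by move: (size H).-1 => _ -> C; exists C.
exists C; first by rewrite cC.
have := char_poly_det C; rewrite cC coef_poly subn0 => /(congr1 absz).
by rewrite !abszM !abszX abszN1 exp1n mul1n => <-.
Qed.

Lemma det_exp_sub_scalar d (C : 'M[int]_d.+1) (s : seq algC) (a : int) n :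
  pZtoC (char_poly C) = \prod_(z <- s) ('X - (a%:~R * z)%:P) ->
  (\det (C ^+ n - (a ^+ n)%:M))%:~R =
    (a ^+ (n * d.+1))%:~R * \prod_(z <- s) (z ^+ n - 1) :> algC.
Proof.
move=> cC; have szs : size s = d.+1.
  have := congr1 (fun p : {poly algC} => size p) cC.
  rewrite size_map_inj_poly ?size_char_poly ?size_prod_XsubC //; last exact: intr_inj.
  by case.
have -> : C ^+ n - (a ^+ n)%:M = horner_mx C ('X^n - (a ^+ n)%:P).
  by rewrite [RHS]rmorphB /= horner_mx_C [in RHS]rmorphXn /= horner_mx_X.
rewrite -det_map_mx map_horner_mx (@det_horner_mx _ _ _ [seq a%:~R * z | z <- s]); last first.
  by rewrite -map_char_poly cC big_map.
rewrite big_map -szs exprM -[_ ^+ size s]iter_mulr_1 -(count_predT s) -big_const_seq.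
rewrite rmorph_prod /= -big_split /=; apply: eq_bigr => z _.
by rewrite rmorphB /= map_polyXn map_polyC /= !hornerE exprMn rmorphXn /= mulrBr mulr1.
Qed.

Lemma finite_Res_Xn_sub_1 (h : {poly int}) (d K : nat) : size h = d.+2 -> h`_0 != 0 ->
  (forall (z : algC) n, (0 < n)%N -> root (pZtoC h) z -> z ^+ n != 1) ->
  finite_set [set n | (0 < n)%N /\ (Res h ('X^n - 1) <= K)%N].
Proof.
move=> szh h0 h_no_unity; pose a := lead_coef h.
have a0 : a != 0 by rewrite lead_coef_eq0 -size_poly_eq0 szh.
have [s Dh] := closed_field_poly_normal (pZtoC h).
rewrite lead_coef_map_inj // -/a in Dh; last exact: intr_inj.
have resE n : (0 < n)%N ->
    (Res h ('X^n - 1))%:R = `|a%:~R| ^+ n * \prod_(z <- s) `|z ^+ n - 1| :> algC.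
  move=> n0; rewrite (Res_roots_l _ Dh) ?monicXnsubC // size_XnsubC //=; congr (_ * _).
  by apply: eq_bigr => z _; rewrite rmorphB rmorph1 /= map_polyXn !hornerE.
have szs : size s = d.+1.
  have := size_prod_XsubC s id; rewrite -(@size_scale _ a%:~R) ?intr_eq0 // -Dh.
  by rewrite size_map_inj_poly ?szh //; [case | exact: intr_inj].
have rs z : z \in s -> root (pZtoC h) z.
  by move=> zs; rewrite Dh rootZ ?intr_eq0 // root_prod_XsubC.
have res_gt0 n : (0 < n)%N -> (0 < Res h ('X^n - 1))%N.
  move=> n0; rewrite lt0n -(pnatr_eq0 algC) resE // mulf_neq0 //.
    by rewrite expf_neq0 // normr_eq0 intr_eq0.
  rewrite prodf_seq_neq0; apply/allP => z zs; rewrite /= normr_eq0 subr_eq0.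
  by apply: h_no_unity (rs z zs).
have unb : forall r N B : nat, (0 < r)%N -> (0 < N)%N ->
    exists m, (B < Res h ('X^(r + N * m) - 1))%N.
  have A1 : 1 <= `|a%:~R| :> algC by rewrite -intr_norm -natr_absz ler1n absz_gt0.
  move=> r N B r0 N0; have [||n n0|m Hm] := @norm_prod_unbounded s _ _ A1 _ _ r N B r0 N0.
  - by case: s szs {Dh resE rs}.
  - have : `|(pZtoC h).[0]| = `|a%:~R| * \prod_(z <- s) `|z|.
      rewrite Dh hornerZ horner_prod normrM normr_prod; congr (_ * _).
      by apply: eq_bigr => z _; rewrite !hornerE normrN.
    rewrite horner_coef0 coef_map /= => <-.
    by rewrite -intr_norm -natr_absz ler1n absz_gt0.
  - by rewrite -resE // ler1n res_gt0.
  by exists m; rewrite -(ltr_nat algC) resE ?addn_gt0 ?r0.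
have [C cC detC] := scaled_companion szh Dh.
(* A prime above [|h_0 a|] divides neither [a] nor the determinant of [C]. *)
have [p p_gt pp] := prime_above (`|(h`_0)%R| * `|a|)%N.
have p2_gt1 : (1 < p ^ 2)%N by rewrite -{1}(exp1n 2) ltn_exp2r // prime_gt1.
have [cop_h cop_a] : coprime p `|(h`_0)%R|%N /\ coprime p `|a|%N.
  have h0' : (0 < `|(h`_0)%R|)%N by rewrite absz_gt0.
  have a0' : (0 < `|a|)%N by rewrite absz_gt0.
  split; rewrite prime_coprime // gtnNdvd // (leq_ltn_trans _ p_gt) //.
    by rewrite leq_pmulr.
  by rewrite leq_pmull.
have [N1 N1_gt0 HN1] : exists2 N, (0 < N)%N &
    forall k, exists B : 'M[int]_d.+1, C ^+ (N * k) = 1 + (p ^ 2)%N%:Z *: B.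
  by apply: exp_mx_mod => //; rewrite detC coprimeXl // coprimeMr cop_h coprimeXr.
(* The integer [a] is treated as a 1 x 1 matrix; [N1 * N2] is then an exponent for both [C] and
   [a]. *)
have [N2 N2_gt0 HN2] : exists2 N, (0 < N)%N &
    forall k, exists B : 'M[int]_1, (a%:M) ^+ (N * k) = 1 + (p ^ 2)%N%:Z *: B.
  by apply: exp_mx_mod => //; rewrite det_scalar1 coprimeXl.
pose N := (N1 * N2)%N; have N_gt0 : (0 < N)%N by rewrite muln_gt0 N1_gt0.
have [B HB] := HN1 N2; have [b Hb] : exists b, a ^+ N = 1 + (p ^ 2)%N%:Z * b.
  have [B1] := HN2 N1; rewrite mulnC -/N => HB1; exists (B1 0 0).
  have := congr1 (fun A : 'M_1 => A 0 0) HB1.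
  by rewrite -rmorphXn !mxE /= mulr1n.
pose S n := \det (C ^+ n - (a ^+ n)%:M).
have absS n : (0 < n)%N -> `|S n|%N = (`|a| ^ (n * d) * Res h ('X^n - 1))%N.
  move=> n0; apply/eqP; rewrite -(eqr_nat algC) natrM resE // natr_absz intr_norm.
  rewrite (det_exp_sub_scalar _ cC) normrM normr_prod natrX natr_absz intr_norm mulrA.
  by rewrite -exprD rmorphXn normrX mulnS addnC.
(* Squares, because [S n] determines the resultant only up to sign. *)
pose f r m := \prod_(c < K.+1)
  (S (r + N * m)%N * S (r + N * m)%N + - (c ^ 2)%:Z * (\prod_(i < 2 * d) a ^+ (r + N * m))).
have p20 : (p ^ 2)%N%:Z != 0 by rewrite eqz_nat -lt0n (ltnW p2_gt1).
have fdiff_dvd_a r : fdiff_dvd (p ^ 2)%N (fun m => a ^+ (r + N * m)).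
  by under [X in fdiff_dvd _ X]funext do rewrite exprD exprM Hb; exact: fdiff_dvd_exp.
have fdiff_dvd_f r : fdiff_dvd (p ^ 2)%N (f r).
  have fdiff_dvd_S : fdiff_dvd (p ^ 2)%N (fun m => S (r + N * m)%N).
    apply: fdiff_dvd_det => // i j.
    have -> : (fun m => (C ^+ (r + N * m) - (a ^+ (r + N * m))%:M) i j) =
        (fun m => (C ^+ r * (1 + (p ^ 2)%N%:Z *: B) ^+ m) i j + - (i == j)%:R * a ^+ (r + N * m)).
      by apply/funext => m; rewrite [LHS]mxE [C ^+ _]exprD exprM HB !mxE mulNr mulr_natl.
    by apply: fdiff_dvdD; [exact: fdiff_dvd_exp_mx | exact: fdiff_dvdZ].
  apply: fdiff_dvd_prod => // c; apply: fdiff_dvdD; first exact: fdiff_dvdM.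
  by apply: fdiff_dvdZ; apply: fdiff_dvd_prod.
(* By [absS] the factor is [|a|^(2dn) (Res^2 - c^2)], so [f r m] vanishes exactly when the resultant
   is one of [0, ..., K]. *)
have fE r m c : (0 < r)%N -> (c < K.+1)%N -> let n := (r + N * m)%N in
  (S n * S n + - (c ^ 2)%:Z * (\prod_(i < 2 * d) a ^+ n) == 0) = (Res h ('X^n - 1) == c).
  move=> r0 cK n; have n0 : (0 < n)%N by rewrite addn_gt0 r0.
  have sq (x : int) : x * x = (`|x| * `|x|)%N by rewrite -abszM gez0_abs // -expr2 sqr_ge0.
  have -> : \prod_(i < 2 * d) a ^+ n = a ^+ (n * d) * a ^+ (n * d).
    by rewrite prodr_const card_ord -exprM -exprD; congr (_ ^+ _); rewrite mulnCA mul2n addnn.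
  rewrite !sq absS // abszX mulNr -PoszM subr_eq0 eqz_nat -mulnn mulnACA [eqbRHS]mulnC.
  by rewrite eqn_pmul2l ?muln_gt0 ?expn_gt0 ?absz_gt0 ?a0 // !mulnn eqn_exp2r.
have fin_r r : (0 < r)%N -> finite_set [set m | f r m = 0].
  move=> r0; have [m Hm] := unb r N K r0 N_gt0.
  apply: (fdiff_dvd_zeros_finite pp (fdiff_dvd_f r) (m0 := m)).
  apply/prodf_neq0 => c _; rewrite fE //.
  by rewrite gtn_eqF // (leq_ltn_trans _ Hm) // -ltnS.
(* The residue classes are represented by [1, ..., N], because [fin_r] needs a positive first
   exponent. *)
apply: (@sub_finite_set _ _
  (\bigcup_(r in `I_N) (fun m => r.+1 + N * m)%N @` [set m | f r.+1 m = 0])).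
  move=> n [n0 resn]; exists (n.-1 %% N)%N; first by rewrite /= ltn_mod.
  exists (n.-1 %/ N)%N; last by have := divn_eq n.-1 N; lia.
  rewrite /=; apply/eqP/prodf_eq0.
  have Kn : (Res h ('X^n - 1) < K.+1)%N by [].
  exists (Ordinal Kn) => //; rewrite fE //=.
  by have -> : ((n.-1 %% N).+1 + N * (n.-1 %/ N) = n)%N; [have := divn_eq n.-1 N; lia | ].
apply: bigcup_finite; first exact: finite_II.
by move=> r _; apply: finite_image; apply: fin_r.
Qed.

(** * Removing the greatest common divisor *)

Lemma ring_dvd_monic (p q : {poly int}) : q \is monic -> q %| p -> ring_dvd q p.
Proof.
move=> mq qp; exists (p %/ q); rewrite Pdiv.IdomainUnit.divpK //.
by rewrite (monicP mq) unitr1.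
Qed.

(** With [d] the order of [z], ['Phi_d] is the minimal polynomial of [z] over Q; as it is monic,
    divisibility over Q gives divisibility in Z[t]. *)
Lemma Cyclotomic_ring_dvd (z : algC) (n : nat) : (0 < n)%N -> z ^+ n = 1 ->
  exists2 d, (0 < d)%N & root (pZtoC 'Phi_d) z /\
    forall p : {poly int}, root (pZtoC p) z -> ring_dvd 'Phi_d p.
Proof.
move=> n0 zn; have [d dz _] := prim_order_exists n0 zn.
exists d; first exact: prim_order_gt0 dz.
have [q [Dq mq] qP] := minCpolyP z.
have ratE (p : {poly int}) : map_poly (ratr : rat -> algC) (map_poly intr p) = pZtoC p.
  by rewrite -map_poly_comp; apply: eq_map_poly => x; rewrite /= ratr_int.
have Eq : q = map_poly intr 'Phi_d.
  apply: (@map_inj_poly _ _ (ratr : rat -> algC)) => //; [exact: fmorph_inj | exact: rmorph0 |].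
    apply: etrans (esym (ratE _)).
  by rewrite -[LHS]Dq (Cintr_Cyclotomic dz) (minCpoly_cyclotomic dz).
split; first by rewrite (Cintr_Cyclotomic dz) -(minCpoly_cyclotomic dz) root_minCpoly.
move=> p; rewrite -ratE qP Eq dvdp_rat_int; apply: ring_dvd_monic.
exact: Cyclotomic_monic.
Qed.

Lemma polyint_unit (c : {poly int}) : c \is a GRing.unit -> c = 1 \/ c = -1.
Proof.
rewrite poly_unitE => /andP [/eqP sz]; have /size_poly1P [x _ ->] : size c == 1%N by rewrite sz.
by rewrite coefC /= => /orP [] /eqP ->; [left | right; rewrite polyCN].
Qed.

Lemma irreducible_monic_dvd (h q : {poly int}) : irreducible_elt h ->
  q \is monic -> (1 < size q)%N -> ring_dvd q h -> h = q \/ h = - q.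
Proof.
move=> [_ _ irr] mq szq [c Dh]; case: (irr _ _ Dh) => [|uq]; last first.
  by move: uq; rewrite poly_unitE; case: eqP szq => // ->.
by case/polyint_unit => Dc; [left | right]; rewrite Dh Dc ?mul1r ?mulN1r.
Qed.

Theorem corollary2p7 (f : {poly int}) :
  f != 0 ->
  (exists h : {poly int},
     [/\ irreducible_elt h, ring_dvd h f, (1 < size h)%N,
         (forall d : nat, (0 < d)%N -> h <> 'Phi_d /\ h <> - 'Phi_d) &
         h <> 'X /\ h <> - 'X]) ->
  forall k : nat, (0 < k)%N ->
  finite_set [set n : nat | (0 < n)%N /\
    let g : {poly int} := 'X^n - 1 in
    let z := monic_gcd f g in
    let F := f %/ z in
    let G := g %/ z in
    (Res F G <= k)%N].
Proof.
move=> f0 [h [irr [c Df] szh hPhi [hX hNX]]] k _.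
have hnz : h != 0 by case: irr.
have h00 : h`_0 != 0.
  apply/eqP => h0; have : ring_dvd 'X h.
    apply: ring_dvd_monic; rewrite ?monicX //.
    by rewrite -['X]subr0 -(polyC0 int) dvdp_XsubCl /root horner_coef0 h0.
  by case/(irreducible_monic_dvd irr (monicX _)); rewrite ?size_polyX.
have hU (z : algC) n : (0 < n)%N -> root (pZtoC h) z -> z ^+ n != 1.
  move=> n0 hz; apply/eqP => zn; have [d d0 [_ Hd]] := Cyclotomic_ring_dvd n0 zn.
  have [h1 h2] := hPhi d d0.
  case: (irreducible_monic_dvd irr (Cyclotomic_monic d) _ (Hd _ hz)) => //.
  by rewrite size_Cyclotomic ltnS totient_gt0.
have [sf Dsf] := closed_field_poly_normal (pZtoC f).
(* A bound for [Res h z] that is independent of [n]. Factors below 1 are raised to 1, so that the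
   product over the roots of [z] is at most the product over all distinct roots of [f]. *)
pose W := \prod_(b <- undup sf) Num.max 1 `|(pZtoC h).[b]|.
pose B := Num.bound W.
have szh2 : size h = (size h).-2.+2 by case: (size h) szh => [|[|]].
(* [Res h g = Res h G * Res h z], where the first factor is at most [Res F G <= k] and the second at
   most [B]. *)
apply: sub_finite_set (finite_Res_Xn_sub_1 (k * B) szh2 h00 hU) => n /= [n0 resn].
split=> //; move: resn; set g : {poly int} := 'X^n - 1.
have mg : g \is monic by exact: monicXnsubC.
have [mz _ _ zmax] := monic_gcdP f mg; have [fE gE] := divp_monic_gcd f mg.
set z := monic_gcd f g in mz zmax fE gE *.
set F := f %/ z in fE *; set G := g %/ z in gE * => resFG.
have mG : G \is monic by move: mg; rewrite gE monicMr.
have [tG DtG] := monic_roots mG; have [tz Dtz] := monic_roots mz.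
have gC : pZtoC g = 'X^n - 1 by rewrite rmorphB rmorph1 /= map_polyXn.
have rootg b : root (pZtoC g) b -> b ^+ n = 1.
  by rewrite gC /root !hornerE subr_eq0 => /eqP.
(* [t^n - 1] is separable, so [G] and [z] have simple roots and no common root. *)
have utGz : uniq (tG ++ tz).
  rewrite -separable_prod_XsubC big_cat /= -DtG -Dtz -rmorphM -gE /= gC.
  by rewrite separable_Xn_sub_1 // pnatr_eq0 -lt0n.
have res_neq0 (p q : {poly int}) t : pZtoC q = \prod_(b <- t) ('X - b%:P) ->
    (forall b, b \in t -> ~~ root (pZtoC p) b) -> (0 < Res p q)%N.
  move=> Dq Hp; rewrite lt0n -(pnatr_eq0 algC) (Res_roots_r _ Dq) prodf_seq_neq0.
  by apply/allP => b bt; rewrite /= normr_eq0; exact: Hp.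
have tz_g b : b \in tz -> root (pZtoC g) b.
  by move=> bt; rewrite gE rmorphM rootM /= Dtz root_prod_XsubC bt orbT.
have tG_g b : b \in tG -> root (pZtoC g) b.
  by move=> bt; rewrite gE rmorphM rootM /= DtG root_prod_XsubC bt.
have res_hz : (0 < Res h z)%N.
  apply: (res_neq0 _ _ _ Dtz) => b /tz_g /rootg bn; apply/negP => /(hU _ _ n0).
  by rewrite bn eqxx.
have cop : coprimep z h.
  rewrite coprimep_sym /coprimep eqn_leq; apply/andP; split.
    by rewrite leqNgt -resultant_eq0 -absz_eq0 -lt0n.
  by rewrite size_poly_gt0 gcdp_eq0 (negbTE hnz).
(* [z] divides [f = c * h] and is coprime to [h], so it divides [c]. *)
have [F1 DF] : ring_dvd h F.
  have [c' Dc] : ring_dvd z c.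
    apply: ring_dvd_monic => //; rewrite -(Gauss_dvdpl c cop) -Df fE.
    exact: dvdp_mull.
  exists c'; apply: (mulIf (monic_neq0 mz)).
  by rewrite -fE Df Dc mulrAC.
(* A common root of [F1] and [G] is a root of unity and a root of [f]. Its cyclotomic polynomial
   divides [f] and [g], hence [z], so that [G] and [z] would share a root. *)
have res_F1 : (0 < Res F1 G)%N.
  apply: (res_neq0 _ _ _ DtG) => b bG; apply/negP => F1b.
  have bg := tG_g b bG; have [d d0 [Phib PhiP]] := Cyclotomic_ring_dvd n0 (rootg b bg).
  have fb : root (pZtoC f) b by rewrite fE DF !rmorphM !rootM /= F1b.
  have [e Dz] := zmax _ (PhiP _ fb) (PhiP _ bg).
  have bz : b \in tz by rewrite -root_prod_XsubC -Dtz Dz rmorphM rootM /= Phib orbT.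
  by move: utGz; rewrite cat_uniq => /and3P [_ /hasPn /(_ _ bz)]; rewrite /= bG.
have res_hzB : (Res h z <= B)%N.
  rewrite -(ler_nat algC) (Res_roots_r _ Dtz).
  have max1 (x : algC) : 1 <= Num.max 1 `|x|.
    by rewrite /Num.max; case: ifP => //; exact: ltW.
  have lemax (x : algC) : `|x| <= Num.max 1 `|x|.
    by rewrite /Num.max; case: ifP => // /negbT; rewrite -real_leNgt.
  have W_ge0 : 0 <= W by apply: prodr_ge0 => b _; exact: le_trans (max1 _).
  apply: le_trans (ltW (archi_boundP W_ge0)).
  apply: (@le_trans _ _ (\prod_(b <- tz) Num.max 1 `|(pZtoC h).[b]|)).
    by apply: ler_prod => b _; rewrite normr_ge0 lemax.
  have ptz : perm_eq tz [seq b <- undup sf | b \in tz].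
    apply: uniq_perm; rewrite ?filter_uniq ?undup_uniq //.
      by move: utGz; rewrite cat_uniq => /and3P [].
    move=> b; rewrite mem_filter mem_undup; case bz: (b \in tz) => //=.
    have : root (pZtoC f) b by rewrite fE rmorphM rootM /= Dtz root_prod_XsubC bz orbT.
    rewrite Dsf rootZ ?root_prod_XsubC //.
    by rewrite lead_coef_eq0 map_poly_eq0_id0 // intr_eq0 lead_coef_eq0.
  rewrite (perm_big _ ptz) big_filter big_mkcond /=; apply: ler_prod => b _.
  by case: ifP; rewrite ?ler01 ?lexx ?max1 ?andbT // (le_trans ler01).
rewrite gE ResMr // leq_mul // (leq_trans _ resFG) // DF ResMl //.
by rewrite leq_pmull.
Qed.
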